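(* Let $k\ge2$. The generating function $\sum_{\pi}y^{N((k-1)(k-2)\dots1k;\pi)}x^{|\pi|}$, where the sum is over all $123$-avoiding permutations $\pi$, is given by the continued fraction $$\cfrac{1}{1-x\left(y^{\binom{0}{k-1}}-1\right)-\cfrac{x}{1-x\left(y^{\binom{1}{k-1}}-1\right)-\cfrac{x}{1-x\left(y^{\binom{2}{k-1}}-1\right)-\cdots}}}\ .$$
   Context: For a permutation $\pi=\pi_1\cdots\pi_n$ of $\{1,\dots,n\}$ and a permutation $\sigma=\sigma_1\cdots\sigma_m$ of $\{1,\dots,m\}$, an occurrence of the pattern $\sigma$ in $\pi$ is a choice of indices $i_1<\dots<i_m$ such that $\pi_{i_1}\cdots\pi_{i_m}$ is in the same relative order as $\sigma$; $\pi$ is $\sigma$-avoiding if there is no occurrence. $N((k-1)(k-2)\dots1k;\pi)$ is the number of occurrences in $\pi$ of the pattern $(k-1)(k-2)\dots 1k$ (the permutation of $\{1,\dots,k\}$ whose first $k-1$ entries are $k-1,k-2,\dots,1$ and whose last entry is $k$). $|\pi|$ denotes the number of elements permuted by $\pi$; the empty permutation is included. The generating function is a formal power series in $x$. *)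

(* Defs.v *)
From HB Require Import structures.
From mathcomp Require Import all_boot all_order all_algebra all_fingroup.
From mathcomp Require Import zify.

Set Implicit Arguments.
Unset Strict Implicit.
Unset Printing Implicit Defensive.

Import GRing.Theory.
Local Open Scope ring_scope.

Section PowerSeries.
Variable R : comUnitRingType.

Definition fps := nat -> R.

Implicit Types f g : fps.

Definition fps_const (c : R) : fps := fun n => c *+ (n == 0%N).

Definition fps_X : fps := fun n => (n == 1%N)%:R.

Definition fps_sub f g : fps := fun n => f n - g n.

Definition fps_mul f g : fps := fun n => \sum_(i < n.+1) f i * g (n - i)%N.

(* [fps_inv_coefs f n] lists the coefficients of degrees 0, ..., n of 1 / f,
   obtained by solving f * g = 1 degree by degree. *)
Fixpoint fps_inv_coefs f n : seq R :=
  if n is m.+1 then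
    let s := fps_inv_coefs f m in
    rcons s (- (f 0%N)^-1 * \sum_(i < m.+1) f i.+1 * s`_(m - i))
  else [:: (f 0%N)^-1].

(* Only meaningful when [f 0] is a unit; see [fps_mulV]. *)
Definition fps_inv f : fps := fun n => (fps_inv_coefs f n)`_n.

Definition fps_div f g : fps := fps_mul f (fps_inv g).

Lemma size_fps_inv_coefs f n : size (fps_inv_coefs f n) = n.+1.
Proof. by elim: n => //= n IHn; rewrite size_rcons IHn. Qed.

Lemma nth_fps_inv_coefs f n i :
  (i <= n)%N -> (fps_inv_coefs f n)`_i = fps_inv f i.
Proof.
elim: n => [|n IHn]; first by rewrite leqn0 => /eqP->.
rewrite leq_eqVlt => /predU1P[-> //|lt_in].
by rewrite /= nth_rcons size_fps_inv_coefs lt_in IHn.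
Qed.

Lemma fps_invS f n :
  fps_inv f n.+1 =
  - (f 0%N)^-1 * \sum_(i < n.+1) f i.+1 * fps_inv f (n - i)%N.
Proof.
rewrite {1}/fps_inv /= nth_rcons size_fps_inv_coefs ltnn eqxx.
congr (_ * _); apply: eq_bigr => i _.
by rewrite nth_fps_inv_coefs // leq_subr.
Qed.

Lemma fps_mulV f : f 0%N \is a GRing.unit ->
  fps_mul f (fps_inv f) =1 fps_const 1.
Proof.
move=> Uf [|n]; rewrite /fps_mul /fps_const big_ord_recl /= subn0.
  by rewrite big_ord0 addr0 divrr.
by rewrite fps_invS mulrA mulrN divrr // mulN1r addNr.
Qed.

(* Convergence in the (X)-adic topology: every coefficient is eventually
   constant. *)
Definition fps_cvg (u : nat -> fps) f :=
  forall n, exists N, forall d, (N <= d)%N -> u d n = f n.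

(* The d-th convergent of the continued fraction
     b_j / (a_j - b_(j+1) / (a_(j+1) - b_(j+2) / (a_(j+2) - ...))),
   i.e. its truncation to d partial quotients. *)
Fixpoint cfrac_convergent (b a : nat -> fps) (j d : nat) : fps :=
  if d is d'.+1 then
    fps_div (b j) (fps_sub (a j) (cfrac_convergent b a j.+1 d'))
  else fps_const 0.

Definition is_cfrac (b a : nat -> fps) f := fps_cvg (cfrac_convergent b a 0) f.

End PowerSeries.

Arguments fps_X {R}.

(* Permutations of {1, ..., n} are represented by ['S_n], i.e. with positions
   and values both shifted to {0, ..., n-1}. *)
Section Patterns.
Variables (m n : nat).
Implicit Types (sigma : 'S_m) (pi : 'S_n).

(* [t] is the choice of indices i_1 < ... < i_m. *)
Definition is_occurrence sigma pi (t : {ffun 'I_m -> 'I_n}) : bool :=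
  [forall a : 'I_m, forall b : 'I_m, (a < b)%N ==> (t a < t b)%N] &&
  [forall a : 'I_m, forall b : 'I_m,
     (pi (t a) < pi (t b))%N == (sigma a < sigma b)%N].

Definition occurrences sigma pi : nat := #|[set t | is_occurrence sigma pi t]|.

Definition avoids sigma pi : bool := ~~ [exists t, is_occurrence sigma pi t].

End Patterns.

Definition pattern123 : 'S_3 := 1%g.

Lemma decr_last_subproof k (i : 'I_k) : (k - i.+2 < k)%N.
Proof. by rewrite ltn_subrL; case: k i => [[]|]. Qed.

Definition decr_last_fun k (i : 'I_k) : 'I_k :=
  if i.+1 == k then i else Ordinal (decr_last_subproof i).

Lemma decr_last_fun_inj k : injective (@decr_last_fun k).
Proof.
move=> i j; rewrite /decr_last_fun; have := ltn_ord i; have := ltn_ord j.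
case: eqP => Ei; case: eqP => Ej ltj lti /(congr1 val) /= E;
  by apply: val_inj => /=; lia.
Qed.

(* The pattern (k-1)(k-2)...1k. *)
Definition decr_last k : 'S_k := perm (@decr_last_fun_inj k).

Lemma decr_last_one_line k : (0 < k)%N ->
  [seq (decr_last k i).+1 | i <- enum 'I_k] = rcons (rev (iota 1 k.-1)) k.
Proof.
case: k => // k _; apply: (@eq_from_nth _ 0%N) => [|i].
  by rewrite size_map size_rcons size_rev size_iota size_enum_ord.
rewrite size_map size_enum_ord => lt_i.
rewrite (nth_map (Ordinal lt_i)) ?size_enum_ord //.
rewrite permE /decr_last_fun nth_rcons size_rev size_iota /=.
set l := nth _ _ _; have El : l = i :> nat by rewrite nth_enum_ord.
case: ifP => [/eqP|/eqP nEl]; first by rewrite El => -[->]; rewrite ltnn eqxx.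
have lt_ik : (i < k)%N by lia.
by rewrite lt_ik nth_rev ?size_iota // nth_iota ?add1n /= ?El; lia.
Qed.

(* The variable y is ['X] in [{poly int}]; x is [fps_X]. *)

Definition avoid123_gf (k : nat) : fps {poly int} := fun n =>
  \sum_(pi : 'S_n | avoids pattern123 pi) 'X^(occurrences (decr_last k) pi).

Definition cf_num (j : nat) : fps {poly int} :=
  if j is 0%N then fps_const 1 else fps_X.

Definition cf_den (k j : nat) : fps {poly int} :=
  fps_sub (fps_const 1) (fps_mul fps_X (fps_const ('X^('C(j, k.-1)) - 1))).

(* Main.v *)
Require Import Defs.
From mathcomp Require Import all_boot all_order all_algebra all_fingroup.
From mathcomp Require Import zify ring.

Set Implicit Arguments.
Unset Strict Implicit.
Unset Printing Implicit Defensive.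

Import GRing.Theory.
Local Open Scope ring_scope.

(** An entry of a permutation [s] is the last entry of as many occurrences of
    (k-1)...1k as there are (k-1)-subsets of the entries that are before it and
    smaller, as soon as [s] avoids 123: those entries are then decreasing.
    Build the permutations by appending a last entry. If [h] is the largest
    value that can be appended, then appending the value 0 leads to [h + 1] and
    appending [r], for [1 <= r <= h], leads to [r] with weight
    [w r = y^'C(r, k-1)].  Hence the series [S h] that counts the extensions
    from [h] satisfies [S h = 1 + x S (h+1) + x \sum_(1 <= r <= h) w r * S r],
    and taking differences, with [S (-1) = 1],
    [S (h-1) = (1 - x (w h - 1)) S h - x S (h+1)].
    The continued fraction is that of the ratios [S h / S (h-1)]. *)

(** * Products and vanishing orders of power series *)

Section FpsTheory.
Variable R : comUnitRingType.
Implicit Types f g h : fps R.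

Lemma eq_fps_mul f f' g g' :
  f =1 f' -> g =1 g' -> fps_mul f g =1 fps_mul f' g'.
Proof. by move=> Ef Eg n; apply: eq_bigr => i _; rewrite Ef Eg. Qed.

(** Truncating to polynomials makes the ring laws of [{poly R}] available for products of series. *)
Lemma fps_mul_coefM f g N n : (n < N)%N ->
  fps_mul f g n = (\poly_(i < N) f i * \poly_(i < N) g i)`_n.
Proof.
move=> lt_nN; rewrite coefM; apply: eq_bigr => i _.
by rewrite !coef_poly !(leq_ltn_trans _ lt_nN) ?leq_subr // -ltnS.
Qed.

Lemma fps_mulC f g : fps_mul f g =1 fps_mul g f.
Proof. by move=> n; rewrite !(@fps_mul_coefM _ _ n.+1) // mulrC. Qed.

Lemma fps_mulA f g h : fps_mul f (fps_mul g h) =1 fps_mul (fps_mul f g) h.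
Proof.
move=> n; pose t u : {poly R} := \poly_(i < n.+1) u i.
transitivity (t f * (t g * t h))`_n.
  rewrite coefM; apply: eq_bigr => i _.
  by rewrite coef_poly ltn_ord (@fps_mul_coefM _ _ n.+1) // ltnS leq_subr.
rewrite mulrA coefM; apply: eq_bigr => i _.
by rewrite coef_poly ltnS leq_subr (@fps_mul_coefM _ _ n.+1).
Qed.

Lemma fps_mulCA f g h : fps_mul f (fps_mul g h) =1 fps_mul g (fps_mul f h).
Proof.
by move=> n; rewrite !fps_mulA; apply: eq_fps_mul => // m; rewrite fps_mulC.
Qed.

Lemma fps_mulBl f g h n :
  fps_mul (fps_sub f g) h n = fps_mul f h n - fps_mul g h n.
Proof. by rewrite -sumrB; apply: eq_bigr => i _; rewrite mulrBl. Qed.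

Lemma fps_mulBr f g h n :
  fps_mul f (fps_sub g h) n = fps_mul f g n - fps_mul f h n.
Proof. by rewrite -sumrB; apply: eq_bigr => i _; rewrite mulrBr. Qed.

Lemma fps_mul_constl c f n : fps_mul (fps_const c) f n = c * f n.
Proof.
rewrite /fps_mul big_ord_recl subn0 big1 ?addr0 // => i _.
by rewrite /fps_const mulr0n mul0r.
Qed.

Lemma fps_mul_X0 f : fps_mul fps_X f 0 = 0.
Proof. by rewrite /fps_mul big_ord_recl big_ord0 mul0r addr0. Qed.

Lemma fps_mul_XS f n : fps_mul fps_X f n.+1 = f n.
Proof.
rewrite /fps_mul 2!big_ord_recl big1 => [|i _]; last by rewrite mul0r.
by rewrite mul0r mul1r add0r addr0 subn1.
Qed.

Definition fps_vanish N f := forall n, (n < N)%N -> f n = 0.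

Lemma fps_vanish_mull N f g : fps_vanish N g -> fps_vanish N (fps_mul f g).
Proof.
move=> g0 n lt_nN; apply: big1 => i _.
by rewrite g0 ?mulr0 // (leq_ltn_trans (leq_subr _ _)).
Qed.

Lemma fps_vanish_mullS N f g :
  f 0%N = 0 -> fps_vanish N g -> fps_vanish N.+1 (fps_mul f g).
Proof.
move=> f0 g0 n lt_nN; apply: big1 => -[[|i] lt_i] _; first by rewrite f0 mul0r.
by rewrite g0 ?mulr0 //=; lia.
Qed.

(** Multiplying by [fps_inv f], which cannot lower the order, recovers [g]. *)
Lemma fps_vanish_unit N f g : f 0%N \is a GRing.unit ->
  fps_vanish N (fps_mul f g) -> fps_vanish N g.
Proof.
move=> Uf fg0 n lt_nN; rewrite -[g n]mul1r -fps_mul_constl.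
rewrite -(@eq_fps_mul _ _ g g (fps_mulV Uf)) // -fps_mulA fps_mulCA.
exact: fps_vanish_mull fg0 _ lt_nN.
Qed.

(** * From a three-term recurrence to a continued fraction *)

Section ThreeTerm.
Variables (b a S : nat -> fps R).
Hypothesis b0 : forall j, b j.+1 0%N = 0.
Hypothesis aU : forall j, a j 0%N \is a GRing.unit.
Hypothesis recS : forall j,
  S j =1 fps_sub (fps_mul (a j) (S j.+1)) (fps_mul (b j.+1) (S j.+2)).

Let cf := cfrac_convergent b a.
(** The tail from level [j] should have the value [b j * S j.+1 / S j]; this is the error of its
    convergent, multiplied by [S j] to avoid the division. *)
Let err j d :=
  fps_sub (fps_mul (cf j d) (S j)) (fps_mul (b j) (S j.+1)).

Let cf0 j d : cf j.+1 d 0%N = 0.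
Proof.
case: d => [|d]; first by rewrite /cf /= /fps_const mul0rn.
by rewrite /cf /= /fps_div /fps_mul big_ord_recl big_ord0 b0 mul0r addr0.
Qed.

Let den j d := fps_sub (a j) (cf j.+1 d).

Let denU j d : den j d 0%N \is a GRing.unit.
Proof. by rewrite /den /fps_sub cf0 subr0. Qed.

(** As [den j d * cf j d.+1 = b j], the left side is [b j * (S j - den j d * S j.+1)], and [recS]
    turns the second factor into [err j.+1 d]. *)
Let den_err j d :
  fps_mul (den j d) (err j d.+1) =1 fps_mul (b j) (err j.+1 d).
Proof.
move=> n; rewrite fps_mulBr.
have -> : fps_mul (den j d) (fps_mul (cf j d.+1) (S j)) n =
          fps_mul (b j) (S j) n.
  rewrite fps_mulA; apply: eq_fps_mul => // m.
  rewrite /cf /= -/cf -/(den j d) /fps_div fps_mulCA fps_mulC.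
  rewrite (@eq_fps_mul _ (fps_const 1) (b j) (b j)) // => [|i].
    by rewrite fps_mul_constl mul1r.
  exact: fps_mulV.
rewrite fps_mulCA -fps_mulBr; apply: eq_fps_mul => // m.
have -> : fps_sub (S j) (fps_mul (den j d) (S j.+1)) m =
          S j m - fps_mul (den j d) (S j.+1) m by [].
by rewrite recS /den fps_mulBl /err /fps_sub; ring.
Qed.

Let err_vanish j d : fps_vanish d (err j.+1 d).
Proof.
elim: d j => // d IHd j; apply: fps_vanish_unit (denU j.+1 d) _ => n lt_n.
by rewrite den_err (fps_vanish_mullS (b0 j) (IHd _)).
Qed.

(* Formal analogue of Pincherle's theorem: [den_err] transports the error of
   the convergents along the recurrence, gaining one order at each level. *)
Lemma is_cfrac_three_term :
  b 0%N =1 fps_const 1 -> S 0%N =1 fps_const 1 -> is_cfrac b a (S 1%N).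
Proof.
move=> b01 S01 n; exists n.+2 => -[//|d] le_nd.
have: err 0 d.+1 n = 0.
  apply: (@fps_vanish_unit d _ _ (denU 0 d)) => // m lt_m.
  by rewrite den_err (fps_vanish_mull (b 0%N) (err_vanish 0 (d:=d))).
move/eqP; rewrite subr_eq0 => /eqP.
rewrite (@eq_fps_mul _ _ (S 1%N) (S 1%N) b01) // fps_mul_constl mul1r => <-.
rewrite fps_mulC (@eq_fps_mul _ _ (cf 0 d.+1) (cf 0 d.+1) S01) //.
by rewrite fps_mul_constl mul1r.
Qed.

End ThreeTerm.
End FpsTheory.

(** * The effect of one appended entry on functions of the bound *)

Section Transfer.
Variables (R : comUnitRingType) (w : nat -> R).

Definition transfer (G : nat -> R) (h : nat) : R :=
  G h.+1 + \sum_(1 <= r < h.+1) w r * G r.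

(** At [h], the coefficient of [x^n] in the series [S h] of the overview. *)
Definition transfer_iter n : nat -> R := iter n transfer (fun=> 1).

(** The sums at [h] and [h.+1] differ only by the term [r = h.+1]. *)
Lemma transfer_iter_diff n h : transfer_iter n.+1 h =
  transfer_iter n.+1 h.+1 - (w h.+1 - 1) * transfer_iter n h.+1
    - transfer_iter n h.+2.
Proof.
rewrite /transfer_iter /= -/(transfer_iter n) /transfer.
by rewrite [in RHS]big_nat_recr //=; ring.
Qed.

End Transfer.

(** * Growing 123-avoiding permutations by a last entry *)

Section Avoidance.

Definition smaller_before n (s : 'S_n) (i : 'I_n) : {set 'I_n} :=
  [set j : 'I_n | (j < i)%N && (s j < s i)%N].

(** Here [i] is the candidate for the middle entry of a 123. *)
Lemma avoids123P n (s : 'S_n) :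
  reflect (forall i j : 'I_n, (i < j)%N -> (s i < s j)%N ->
             smaller_before s i = set0)
          (avoids pattern123 s).
Proof.
apply: (iffP idP) => [av_s b c lt_bc lt_sbc | sP].
  apply/eqP/set0Pn => -[a]; rewrite inE => /andP[lt_ab lt_sab].
  case/existsP: av_s; exists [ffun i => tnth [tuple a; b; c] i].
  by apply/andP; split; apply/forallP=> -[[|[|[|//]]] ?]; apply/forallP;
    case=> [[|[|[|//]]] ?]; rewrite !ffunE !(tnth_nth a) /= ?perm1 //=;
    apply/eqP; lia.
apply/existsP => -[t /andP[/forallP t_lt /forallP t_s]].
have lt (i j : 'I_3) : (i < j)%N -> (t i < t j)%N && (s (t i) < s (t j))%N.
  move=> lt_ij; have /forallP/(_ j)/implyP-> // := t_lt i.
  by have /forallP/(_ j)/eqP-> := t_s i; rewrite !perm1.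
pose i0 : 'I_3 := ord0; pose i1 : 'I_3 := inord 1; pose i2 : 'I_3 := ord_max.
have /andP[lt12 lt_s12] : (t i1 < t i2)%N && (s (t i1) < s (t i2))%N.
  by apply: lt; rewrite inordK.
have /setP/(_ (t i0)) := sP _ _ lt12 lt_s12.
by rewrite !inE lt // inordK.
Qed.

(* The values that can be appended to [s] without creating 123 are those that
   do not exceed any value with a smaller one before it. *)
Definition append_bound n (s : 'S_n) : nat :=
  (n - \max_(i | smaller_before s i != set0) (n - s i))%N.

(** The bound is a minimum, written as [n] minus a maximum so that the empty case yields [n]. *)
Lemma leq_append_boundP n (s : 'S_n) v :
  reflect ((v <= n)%N /\
             forall i, smaller_before s i != set0 -> (v <= s i)%N)
          (v <= append_bound s)%N.
Proof.
rewrite /append_bound.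
have le_max : (\max_(i | smaller_before s i != set0) (n - s i) <= n)%N.
  by apply/bigmax_leqP => i _; exact: leq_subr.
apply: (iffP idP) => [le_v | [le_vn sP]].
  split=> [|i i_nz]; first by lia.
  have /bigmax_leqP/(_ i i_nz) :
    (\max_(i | smaller_before s i != set0) (n - s i) <= n - v)%N by lia.
  by have := ltn_ord (s i); lia.
suff : (\max_(i | smaller_before s i != set0) (n - s i) <= n - v)%N by lia.
by apply/bigmax_leqP => i /sP; have := ltn_ord (s i); lia.
Qed.

Section Append.
Variables (n : nat) (v : 'I_n.+1) (s : 'S_n).

(** Old values that are at least [v] move up by one, which keeps their relative order. *)
Definition perm_append : 'S_n.+1 := lift_perm ord_max v s.

Lemma perm_append_max : perm_append ord_max = v.
Proof. exact: lift_perm_id. Qed.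

Lemma perm_append_lift i : perm_append (lift ord_max i) = bump v (s i) :> nat.
Proof. by rewrite lift_perm_lift. Qed.

Lemma smaller_before_lift i :
  smaller_before perm_append (lift ord_max i) =
  [set lift ord_max j | j in smaller_before s i].
Proof.
apply/setP=> j; apply/idP/imsetP => [|[k lt_k ->]]; last first.
  move: lt_k; rewrite !inE !perm_append_lift !lift_max.
  by rewrite [(bump _ _ < _)%N]ltnNge leq_bump2 -ltnNge.
case: (unliftP ord_max j) => [k|] ->; last first.
  by rewrite inE lift_max ltnNge ltnW //=.
rewrite inE !lift_max !perm_append_lift.
rewrite [(bump _ _ < _)%N]ltnNge leq_bump2 -ltnNge => lt_k.
by exists k; rewrite ?inE.
Qed.

Lemma smaller_before_max :
  smaller_before perm_append ord_max =
  [set lift ord_max j | j in [set j | (s j < v)%N]].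
Proof.
apply/setP=> j; apply/idP/imsetP => [|[k lt_k ->]]; last first.
  move: lt_k; rewrite !inE lift_max perm_append_max perm_append_lift /bump.
  by have := ltn_ord k; move=> /= ? ?; apply/andP; split=> //; lia.
case: (unliftP ord_max j) => [k|] ->; last by rewrite inE ltnn.
rewrite inE lift_max perm_append_max perm_append_lift /bump => /andP[_ lt_k].
by exists k => //; rewrite inE; lia.
Qed.

Lemma card_smaller_before_lift i :
  #|smaller_before perm_append (lift ord_max i)| = #|smaller_before s i|.
Proof. by rewrite smaller_before_lift card_imset //; exact: lift_inj. Qed.

(** [s] takes each of the [v] values below [v] exactly once. *)
Lemma card_smaller_before_max : #|smaller_before perm_append ord_max| = v.
Proof.
rewrite smaller_before_max card_imset; last exact: lift_inj.
have -> : [set j | (s j < v)%N] = s @^-1: [set j : 'I_n | (j < v)%N].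
  by apply/setP=> j; rewrite !inE.
rewrite on_card_preimset; last first.
  by exists s^-1%g => j _; rewrite ?permK ?permKV.
have le_vn : (v <= n)%N by rewrite -ltnS.
have -> : [set j : 'I_n | (j < v)%N] = [set widen_ord le_vn i | i : 'I_v].
  apply/setP=> j; rewrite inE; apply/idP/imsetP => [lt_j | [i _ ->]].
    by exists (Ordinal lt_j) => //; apply: val_inj.
  exact: (ltn_ord i).
by rewrite card_imset ?card_ord // => i j [] /val_inj.
Qed.

Lemma smaller_before_lift_eq0 i :
  (smaller_before perm_append (lift ord_max i) == set0) =
  (smaller_before s i == set0).
Proof. by rewrite -!cards_eq0 card_smaller_before_lift. Qed.

Lemma smaller_before_max_eq0 :
  (smaller_before perm_append ord_max == set0) = (v == 0%N :> nat).
Proof. by rewrite -cards_eq0 card_smaller_before_max. Qed.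

(** A new 123 must end at the appended entry, so its middle is an old entry below [v] with a smaller
    one before it. *)
Lemma avoids123_append :
  avoids pattern123 perm_append =
  avoids pattern123 s && (v <= append_bound s)%N.
Proof.
apply/avoids123P/andP => [sP | [/avoids123P sP /leq_append_boundP[_ le_v]] i j].
  split.
    apply/avoids123P => i j lt_ij lt_sij; apply/eqP.
    rewrite -smaller_before_lift_eq0; apply/eqP; apply: (sP _ (lift ord_max j)).
      by rewrite !lift_max.
    by rewrite !perm_append_lift ltnNge leq_bump2 -ltnNge.
  apply/leq_append_boundP; split=> [|i]; first by rewrite -ltnS.
  rewrite -smaller_before_lift_eq0; apply: contraR; rewrite -ltnNge => lt_v.
  apply/eqP/(sP _ ord_max); first by rewrite lift_max.
  by rewrite perm_append_max perm_append_lift /bump; lia.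
case: (unliftP ord_max i) => [{}i|] ->; last first.
  by move=> lt_j; have := ltn_ord j; rewrite ltnS leqNgt lt_j.
case: (unliftP ord_max j) => [{}j|] ->.
  rewrite !lift_max !perm_append_lift => lt_ij.
  rewrite ltnNge leq_bump2 -ltnNge => lt_sij.
  by apply/eqP; rewrite smaller_before_lift_eq0 (sP i j).
rewrite perm_append_max perm_append_lift /bump => _ lt_v.
apply/eqP; rewrite smaller_before_lift_eq0.
by apply: contraLR lt_v => /le_v; lia.
Qed.

(** A last entry [v > 0] has a smaller entry before it and so becomes the new minimum; a last entry
    0 imposes nothing and raises every old value by one. *)
Lemma append_bound_append : (v <= append_bound s)%N ->
  append_bound perm_append =
  if v == 0%N :> nat then (append_bound s).+1 else v.
Proof.
move=> /leq_append_boundP[le_vn le_v].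
have /leq_append_boundP[le_n le_s] := leqnn (append_bound s).
have /leq_append_boundP[le_n' le_s'] := leqnn (append_bound perm_append).
apply/eqP; rewrite eqn_leq; apply/andP; split.
  case: ifP => [/eqP v0 | v_nz]; last first.
    by have := le_s' ord_max; rewrite smaller_before_max_eq0 v_nz
      perm_append_max; apply.
  suff : ((append_bound perm_append).-1 <= append_bound s)%N by lia.
  apply/leq_append_boundP; split=> [|i]; first by lia.
  rewrite -smaller_before_lift_eq0 => /le_s'.
  by rewrite perm_append_lift /bump v0; lia.
apply/leq_append_boundP; split=> [|i]; first by case: ifP; lia.
case: (unliftP ord_max i) => [{}i|] ->.
  rewrite smaller_before_lift_eq0 perm_append_lift => i_nz.
  by have := le_v i i_nz; have := le_s i i_nz; rewrite /bump; case: ifP; lia.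
by rewrite smaller_before_max_eq0 perm_append_max => /negPf->.
Qed.

End Append.

Lemma perm_append_bij n :
  bijective (fun vs : 'I_n.+1 * 'S_n => perm_append vs.1 vs.2).
Proof.
apply: inj_card_bij => [[v s] [v' s'] /= E|]; last first.
  by rewrite card_prod card_ord !card_Sn factS.
have Ev : v = v' by rewrite -(perm_append_max v s) E perm_append_max.
rewrite -{}Ev in E *; congr (_, _); apply/permP=> i; apply: (@lift_inj _ v).
by rewrite -!(lift_perm_lift ord_max) -/(perm_append v s) E.
Qed.

(** * Weighted enumeration, one entry at a time *)

Section Weights.
Variables (R : comUnitRingType) (w : nat -> R).
Hypothesis w0 : w 0 = 1.

(** [G] stands for the contribution of the entries still to be appended. *)
Definition avoid123_weight (G : nat -> R) n : R :=
  \sum_(s : 'S_n | avoids pattern123 s)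
     (\prod_(i < n) w #|smaller_before s i|) * G (append_bound s).

Lemma avoid123_weightS G n :
  avoid123_weight G n.+1 = avoid123_weight (transfer w G) n.
Proof.
rewrite /avoid123_weight (reindex _ (onW_bij _ (perm_append_bij n))) /=.
rewrite -(pair_big_dep xpredT
  (fun v s => avoids pattern123 (perm_append v s))
  (fun v s => (\prod_(i < n.+1) w #|smaller_before (perm_append v s) i|) *
     G (append_bound (perm_append v s)))) /=.
rewrite (exchange_big_dep (fun s : 'S_n => avoids pattern123 s)) /=; last first.
  by move=> v s _; rewrite avoids123_append => /andP[].
apply: eq_bigr => s av_s; rewrite /transfer.
have le_n : (append_bound s <= n)%N by exact: leq_subr.
(* Old entries keep their weights, and the last one contributes [w v]. *)
transitivity (\sum_(0 <= v < n.+1 | (v < (append_bound s).+1)%N)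
  (\prod_(i < n) w #|smaller_before s i|) *
  (w v * G (if v == 0%N then (append_bound s).+1 else v))).
  rewrite big_mkord; apply: eq_big => v; first by rewrite avoids123_append av_s.
  rewrite avoids123_append => /andP[_ le_v].
  rewrite big_ord_recr /= card_smaller_before_max append_bound_append //.
  rewrite mulrA; congr (_ * _ * _); apply: eq_bigr => i _.
  rewrite -(card_smaller_before_lift v); congr (w #|smaller_before _ _|).
  by apply: val_inj; rewrite /= /bump leqNgt ltn_ord.
rewrite -(big_nat_widen _ _ _ xpredT) // -mulr_sumr big_ltn //= w0 mul1r.
congr (_ * (_ + _)); apply: eq_big_nat => v /andP[v_gt0 _].
by rewrite -(prednK v_gt0).
Qed.

Lemma avoid123_weightE n : avoid123_weight (fun=> 1) n = transfer_iter w n 0.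
Proof.
(* Generalised over [m], since each entry removed from [s] adds one [transfer]; the empty
   permutation has bound 0. *)
suff E m : avoid123_weight (transfer_iter w m) n = transfer_iter w (n + m) 0.
  by rewrite (E 0%N) addn0.
elim: n m => [|n IHn] m; last first.
  by rewrite avoid123_weightS -[transfer w _]/(transfer_iter w m.+1) IHn addnS.
rewrite /avoid123_weight add0n (big_pred1 1%g) => [|s].
  by rewrite big_ord0 mul1r.
have -> : s = 1%g by apply/permP => -[].
by rewrite /= eqxx; apply/avoids123P => -[].
Qed.

End Weights.

End Avoidance.

(** * Counting occurrences by their last entry *)

Section Occurrences.
Variables (m n : nat) (s : 'S_n).
Hypothesis av_s : avoids pattern123 s.

Lemma decr_last_lt (a b : 'I_m.+1) :
  (decr_last m.+1 a < decr_last m.+1 b)%N =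
  (a < m)%N && ((b == ord_max) || (b < a)%N).
Proof.
rewrite !permE /decr_last_fun -val_eqE /=.
have := ltn_ord a; have := ltn_ord b.
by case: ifP; case: ifP => /=; lia.
Qed.

(* The entries playing the roles of k-1, ..., 1 are smaller than and before a
   common entry, so 123-avoidance forces them to decrease. *)
Lemma is_occurrence_decr_last (t : {ffun 'I_m.+1 -> 'I_n}) :
  is_occurrence (decr_last m.+1) s t =
  [forall a : 'I_m.+1, forall b : 'I_m.+1, (a < b)%N ==> (t a < t b)%N] &&
  [forall a : 'I_m.+1, (a < m)%N ==> (s (t a) < s (t ord_max))%N].
Proof.
rewrite /is_occurrence; case t_lt: [forall a, _] => //=.
have {}t_lt (a b : 'I_m.+1) : (a < b)%N -> (t a < t b)%N.
  by move=> lt_ab; move/forallP/(_ a)/forallP/(_ b): t_lt; rewrite lt_ab.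
apply/forallP/forallP => [t_s a | t_s a].
  apply/implyP=> lt_a; have /forallP/(_ ord_max)/eqP-> := t_s a.
  by rewrite decr_last_lt lt_a eqxx.
have {}t_s (c : 'I_m.+1) : (c < m)%N -> (s (t c) < s (t ord_max))%N.
  exact/implyP.
have decr (c d : 'I_m.+1) : (c < d)%N -> (d < m)%N -> (s (t d) < s (t c))%N.
  move=> lt_cd lt_d; rewrite ltn_neqAle leqNgt; apply/andP; split.
    apply: contraTneq (t_lt _ _ lt_cd) => /val_inj/perm_inj->.
    by rewrite ltnn.
  apply/negP=> lt_s.
  have /setP/(_ (t c)) :=
    (avoids123P s av_s) (t d) (t ord_max) (t_lt _ ord_max lt_d) (t_s _ lt_d).
  by rewrite !inE lt_s t_lt.
have max (c : 'I_m.+1) : (c < m)%N = false -> c = ord_max.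
  by move=> lt_c; apply: val_inj => /=; have := ltn_ord c; lia.
apply/forallP=> b; apply/eqP; rewrite decr_last_lt.
case lt_a: (a < m)%N => /=; last first.
  rewrite (max _ lt_a); case lt_b: (b < m)%N; last by rewrite (max _ lt_b) ltnn.
  by apply: negbTE; rewrite -leqNgt ltnW // t_s.
case lt_b: (b < m)%N; last by rewrite (max _ lt_b) t_s // eqxx.
rewrite -val_eqE /= (ltn_eqF lt_b) /=.
case: (ltngtP b a) => [lt_ba | lt_ab | /val_inj->]; last by rewrite ltnn.
  by rewrite decr.
by apply: negbTE; rewrite -leqNgt ltnW // decr.
Qed.

Lemma sorted_enum_ord (A : {set 'I_n}) :
  sorted (relpre val ltn) (enum A).
Proof.
rewrite -sorted_map /enum_mem -enumT.
rewrite (subseq_sorted ltn_trans (map_subseq _ (filter_subseq _ _))) //.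
by rewrite val_enum_ord iota_ltn_sorted.
Qed.

Let ltrel : rel 'I_n := relpre val ltn.
Let ltrel_trans : transitive ltrel.
Proof. by move=> y x z; exact: ltn_trans. Qed.
Let ltrel_irr : irreflexive ltrel.
Proof. by move=> x; rewrite /ltrel /= ltnn. Qed.

(** The first [m] positions form an [m]-subset of [smaller_before s i], and listing such a subset in
    increasing order recovers the occurrence. *)
Lemma card_occurrences_at i :
  #|[set t | is_occurrence (decr_last m.+1) s t & t ord_max == i]| =
  'C(#|smaller_before s i|, m).
Proof.
rewrite -cards_draws.
pose wid : 'I_m -> 'I_m.+1 := widen_ord (leqnSn m).
pose init (t : {ffun 'I_m.+1 -> 'I_n}) := [seq t (wid a) | a <- enum 'I_m].
pose f t := [set j in init t].
have initP t : is_occurrence (decr_last m.+1) s t -> sorted ltrel (init t).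
  rewrite is_occurrence_decr_last => /andP[/forallP t_lt _].
  rewrite /init sorted_map.
  apply: (@sub_sorted _ (relpre val ltn)) => [a b lt_ab|].
    by have /forallP/(_ (wid b))/implyP := t_lt (wid a); apply.
  by rewrite -sorted_map val_enum_ord iota_ltn_sorted.
have size_init t : size (init t) = m by rewrite size_map size_enum_ord.
rewrite -(@card_in_imset _ _ f) => [|t t']; last first.
  rewrite !inE => /andP[occ_t /eqP max_t] /andP[occ_t' /eqP max_t'] /setP E.
  have Ei : init t = init t'.
    apply: (irr_sorted_eq ltrel_trans ltrel_irr); rewrite ?initP // => j.
    by have := E j; rewrite !inE.
  apply/ffunP=> a; case: (ltnP a m) => [lt_a | le_a]; last first.
    have -> : a = ord_max by apply: val_inj => /=; have := ltn_ord a; lia.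
    by rewrite max_t max_t'.
  have : nth i (init t) a = nth i (init t') a by rewrite Ei.
  have Ea: a = wid (Ordinal lt_a) by apply: val_inj.
  rewrite /init !(nth_map (Ordinal lt_a)) -?enumT ?size_enum_ord //.
  have -> : nth (Ordinal lt_a) (enum 'I_m) a = Ordinal lt_a.
    exact: (nth_ord_enum (Ordinal lt_a) (Ordinal lt_a)).
  by rewrite -Ea.
apply: eq_card => A; rewrite inE.
apply/imsetP/andP => [[t] | [sub_A /eqP card_A]].
  rewrite inE => /andP[occ_t /eqP max_t] ->; split.
    apply/subsetP=> j; rewrite !inE => /mapP[a _ ->].
    move: occ_t; rewrite is_occurrence_decr_last -max_t.
    move=> /andP[/forallP t_lt /forallP t_s].
    have lt_a : (wid a < m)%N := ltn_ord a.
    have /forallP/(_ ord_max)/implyP/(_ lt_a)-> := t_lt (wid a).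
    by have /implyP/(_ lt_a) := t_s (wid a).
  have /card_uniqP : uniq (init t).
    by apply: (sorted_uniq ltrel_trans ltrel_irr); exact: initP.
  by rewrite size_init => <-; apply/eqP/eq_card => j; rewrite inE.
(* [enum A] has size [m], so the default [i] is the value at [ord_max]. *)
pose t : {ffun 'I_m.+1 -> 'I_n} := [ffun a : 'I_m.+1 => nth i (enum A) a].
have size_A : size (enum A) = m by rewrite -cardE.
have t_max : t ord_max = i by rewrite ffunE nth_default ?size_A.
have tA (a : 'I_m.+1) : (a < m)%N -> t a \in A.
  by move=> lt_a; rewrite ffunE -mem_enum mem_nth ?size_A.
have t_sb (a : 'I_m.+1) : (a < m)%N -> (t a < i)%N && (s (t a) < s i)%N.
  by move=> /tA/(subsetP sub_A); rewrite inE.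
exists t; last first.
  apply/setP=> j; rewrite inE; apply/idP/mapP => [jA | [a _ ->]]; last first.
    exact: (tA (wid a) (ltn_ord a)).
  have lt_j : (index j (enum A) < m)%N by rewrite -size_A index_mem mem_enum.
  by exists (Ordinal lt_j); rewrite ?mem_enum // ffunE /= nth_index ?mem_enum.
rewrite inE t_max eqxx andbT is_occurrence_decr_last; apply/andP; split.
  apply/forallP=> a; apply/forallP=> b; apply/implyP=> lt_ab.
  case: (ltnP b m) => [lt_b | le_b].
    rewrite !ffunE.
    apply: (sorted_ltn_nth ltrel_trans); rewrite ?inE ?size_A //.
      exact: sorted_enum_ord.
    exact: ltn_trans lt_b.
  have -> : b = ord_max by apply: val_inj => /=; have := ltn_ord b; lia.
  have lt_a : (a < m)%N by have := ltn_ord b; lia.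
  by rewrite t_max; case/andP: (t_sb a lt_a).
apply/forallP=> a; apply/implyP=> /t_sb/andP[_].
by rewrite t_max.
Qed.

Lemma occurrences_decr_last :
  occurrences (decr_last m.+1) s =
  (\sum_(i < n) 'C(#|smaller_before s i|, m))%N.
Proof.
rewrite /occurrences -sum1dep_card.
rewrite (partition_big
  (fun t : {ffun 'I_m.+1 -> 'I_n} => t ord_max) xpredT) //=.
by apply: eq_bigr => i _; rewrite sum1dep_card card_occurrences_at.
Qed.

End Occurrences.

(* The recurrence for the weights [y^'C(r, k-1)] *)
Local Close Scope ring_scope.

Theorem theorem8 (k : nat) (hk : 2 <= k) :
  is_cfrac cf_num (cf_den k) (avoid123_gf k).
Proof.
case: k hk => [//|m]; rewrite ltnS => m_gt0.
pose w r : {poly int} := ('X^('C(r, m)))%R.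
(* This is where [2 <= k] enters: an appended 0 ends no occurrence. *)
have w0 : w 0 = 1%R by rewrite /w bin0n eqn0Ngt m_gt0.
(* Indices are shifted by one from the overview: [S 0] is its [S (-1) = 1]. *)
pose S j : fps {poly int} :=
  if j is i.+1 then fun n => transfer_iter w n i else fps_const 1%R.
have denE j f n : fps_mul (cf_den m.+1 j) f n =
    (f n - fps_mul fps_X (fps_mul (fps_const (w j - 1)) f) n)%R.
  by rewrite fps_mulBl fps_mul_constl mul1r fps_mulA.
have gfE : avoid123_gf m.+1 =1 S 1.
  move=> n; rewrite /= -avoid123_weightE //; apply: eq_bigr => s av_s.
  rewrite mulr1 occurrences_decr_last //.
  by rewrite (big_morph (fun e => 'X^e)%R (@exprD _ 'X%R) (expr0 _)).
have Scf : is_cfrac cf_num (cf_den m.+1) (S 1).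
  apply: is_cfrac_three_term => // [j | j n].
    have := denE j (fps_const 1%R) 0.
    rewrite /fps_mul !big_ord_recl !big_ord0 /fps_const /= mulr1 !mul0r !addr0.
    by rewrite subr0 => ->; exact: unitr1.
  rewrite /fps_sub denE; case: n => [|n].
    by rewrite !fps_mul_X0 !subr0; case: j.
  rewrite !fps_mul_XS fps_mul_constl.
  (* At level 0 the sum over [1 <= r < 1] is empty and only the appended 0 remains. *)
  case: j => [|j]; last exact: transfer_iter_diff.
  by rewrite w0 subrr mul0r subr0 /= /transfer big_geq // addr0 subrr.
by move=> n; have [N cvgN] := Scf n; exists N => d /cvgN->; rewrite gfE.
Qed.
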